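(* Let $T>0$ and let $\phi:[0,T]\to\mathbb{R}$ be such that $\phi$ is continuous on $[0,T]$, $\phi$ is differentiable on $(0,T)$ with $\phi'$ having at worst an integrable singularity at $t=0$, and $\phi(0)\neq 0$. Extend $\phi$ to $[0,\infty)$ by $\phi(t)=0$ for $t>T$, and let $\hat\phi(s)=\int_0^\infty e^{-st}\phi(t)\,dt$ be its Laplace transform. Suppose that there exists a locally integrable function $\psi^\star$ on $[0,\infty)$ whose Laplace transform, for all sufficiently large $s>0$, is $$\hat\psi^\star(s) = \frac{1}{s\,\hat\phi(s)} - \frac{1}{\phi(0)}.$$ For a function $u$ on $[0,T]$ set $$J_{\psi^\star}u(t) = \int_0^t \psi^\star(t-\tau)u(\tau)\,d\tau,\qquad \tilde J_\psi u(t) = \frac{1}{\phi(0)}u(t) + J_{\psi^\star}u(t).$$ Then for every $f\in AC[0,T]$ and $0<t\le T$, $$D_\phi\bigl[\tilde J_\psi f\bigr](t) = f(t) - \frac{\phi(t)}{\phi(0)}f(0) - \phi(t)\cdot\lim_{r\to 0^+} J_{\psi^\star}f(r).$$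
   Context: For $h\in AC[0,T]$, $D_\phi h(t) := \int_0^t \phi(t-\tau)h'(\tau)\,d\tau$ for $0<t\le T$. $AC[0,T]$ is the space of absolutely continuous functions on $[0,T]$: $f\in AC[0,T]$ if and only if $f(t)=f(0)+\int_0^t f'(s)\,ds$ for $0\le t\le T$ with some $f'\in L^1[0,T]$. The Laplace transform of a function $g$ on $[0,\infty)$ is $\hat g(s)=\int_0^\infty e^{-st}g(t)\,dt$. *)

(* Defs.v *)
From HB Require Import structures.
From mathcomp Require Import all_boot all_order all_algebra.
From mathcomp Require Import all_classical all_reals all_analysis.
Set Implicit Arguments.
Unset Strict Implicit.
Unset Printing Implicit Defensive.
Import Order.TTheory GRing.Theory Num.Theory.
Import numFieldNormedType.Exports.
Local Open Scope classical_set_scope.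
Local Open Scope ring_scope.

(* A function on [0, T] (resp. [0, oo[) is represented by a function on R of
   which only the values on that interval matter. *)

Definition is_ac_deriv (R : realType) (T : R) (f g : R -> R) : Prop :=
  (@lebesgue_measure R).-integrable `[0, T] (EFin \o g) /\
  forall t, 0 <= t <= T ->
    f t = f 0 + \int[@lebesgue_measure R]_(s in `[0, t]) g s.

Definition abs_cont (R : realType) (T : R) (f : R -> R) : Prop :=
  exists g, is_ac_deriv T f g.

(* Any two derivatives of f in the sense of [is_ac_deriv] agree almost
   everywhere on [0, T], so the choice made here does not affect integrals. *)
Definition ac_deriv (R : realType) (T : R) (f : R -> R) : R -> R :=
  xget (cst 0) [set g | is_ac_deriv T f g].

Definition Dop (R : realType) (T : R) (phi h : R -> R) (t : R) : R :=
  \int[@lebesgue_measure R]_(tau in `[0, t])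
    (phi (t - tau) * ac_deriv T h tau).

Definition zero_ext (R : realType) (T : R) (phi : R -> R) (t : R) : R :=
  if t <= T then phi t else 0.

Definition laplace_integrand (R : realType) (g : R -> R) (s t : R) : R :=
  expR (- (s * t)) * g t.

Definition laplace (R : realType) (g : R -> R) (s : R) : R :=
  \int[@lebesgue_measure R]_(t in `[0, +oo[) laplace_integrand g s t.

(* [Rintegral] is total, so convergence of the Laplace integral has to be
   required separately. *)
Definition has_laplace (R : realType) (g : R -> R) (s : R) : Prop :=
  (@lebesgue_measure R).-integrable `[0, +oo[
    (EFin \o laplace_integrand g s).

(* Local integrability on the half-line [0, oo[, including at 0; the library's
   [locally_integrable] is restricted to open domains. *)
Definition loc_integrable_halfline (R : realType) (g : R -> R) : Prop :=
  forall b : R, 0 < b ->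
    (@lebesgue_measure R).-integrable `[0, b] (EFin \o g).

Definition Jop (R : realType) (psi u : R -> R) (t : R) : R :=
  \int[@lebesgue_measure R]_(tau in `[0, t]) (psi (t - tau) * u tau).

Definition Jtilde (R : realType) (phi psi u : R -> R) (t : R) : R :=
  (phi 0)^-1 * u t + Jop psi u t.

(* Main.v *)
Require Import Defs.
From HB Require Import structures.
From mathcomp Require Import all_boot all_order all_algebra.
From mathcomp Require Import all_classical all_reals all_analysis.
From mathcomp Require Import measurable_realfun ring lra.
Set Implicit Arguments.
Unset Strict Implicit.
Unset Printing Implicit Defensive.
Import Order.TTheory GRing.Theory Num.Theory.
Import numFieldNormedType.Exports.
Local Open Scope classical_set_scope.
Local Open Scope ring_scope.

(* Write * for convolution, H for the Heaviside function, p for the derivative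
   of f, and extend everything by 0 off [0, T]. The Laplace hypothesis says
   that phi * psi + phi / phi(0) - 1 has Laplace transform 0 for large s, so by
   injectivity of the transform and continuity
     phi * psi = 1 - phi / phi(0)   on [0, T].
   Since f = f(0) + H * p, J f = H * q with q = f(0) psi + psi * p integrable:
   J f is absolutely continuous and tends to 0 at 0+, and D_phi (J~ f) is
     phi * (p / phi(0) + q) = phi * p / phi(0) + f(0) (1 - phi / phi(0))
                              + (1 - phi / phi(0)) * p
                            = f - f(0) phi / phi(0). *)

(** * Convolution on the line *)

Section Convolution.
Context {R : realType}.
Notation mu := (@lebesgue_measure R).
Implicit Types (a b f g K : R -> R).

Lemma measurable_reflect (c : R) : measurable_fun setT (fun x : R => c - x).
Proof. exact: measurable_funB. Qed.

(** By uniqueness of Lebesgue measure it suffices to compare half-open intervals, whose length a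
    reflection preserves. *)
Lemma lebesgue_measure_reflect (c : R) (A : set R) : measurable A ->
  mu A = pushforward mu ((fun x => c - x) : _ -> measurableTypeR R) A.
Proof.
move=> mA; apply: lebesgue_measure_unique => //=.
  exact: measurable_reflect.
move=> mc _ [[u v] _ <-] /=; rewrite /pushforward/=.
have -> : (fun x => c - x) @^-1` `]u, v] = `[c - v, c - u[%classic.
  by apply/seteqP; split => x /=; rewrite !in_itv/= lerBlDr lerBlDr ltrBrDr ltrBrDr
    [x + u]addrC [x + v]addrC andbC.
rewrite !lebesgue_measure_itv/= !lte_fin ltrD2l ltrN2; case: ifP => // _.
by rewrite -!EFinB opprB [c - u + _]addrC addrA subrK.
Qed.

Lemma ge0_integral_reflect (c : R) (f : R -> \bar R) : measurable_fun setT f ->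
  (forall x, 0 <= f x)%E ->
  (\int[mu]_x f (c - x)%R = \int[mu]_x f x)%E.
Proof.
move=> mf f0.
have := @ge0_integral_pushforward _ _ (measurableTypeR R) (measurableTypeR R) R
  (fun x => c - x) (measurable_reflect c) mu setT f measurableT mf.
rewrite preimage_setT => <- //.
apply: eq_measure_integral => [|mc A mA _]; first exact: measurable_reflect.
exact/esym/lebesgue_measure_reflect.
Qed.

Lemma integral_reflect (c : R) (f : R -> \bar R) : measurable_fun setT f ->
  (\int[mu]_x f (c - x)%R = \int[mu]_x f x)%E.
Proof.
move=> mf; rewrite integralE [RHS]integralE.
congr (_ - _)%E.
- under eq_integral do rewrite (funepos_comp f (fun x => c - x)).
  by apply: ge0_integral_reflect => //; exact: measurable_funepos.
- under eq_integral do rewrite (funeneg_comp f (fun x => c - x)).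
  by apply: ge0_integral_reflect => //; exact: measurable_funeneg.
Qed.

(** A translation is a product of two reflections: [x - c = - c - (0 - x)]. *)
Lemma integral_translate (c : R) (f : R -> \bar R) : measurable_fun setT f ->
  (\int[mu]_x f (x - c)%R = \int[mu]_x f x)%E.
Proof.
move=> mf; rewrite -(integral_reflect (- c) mf).
rewrite -(integral_reflect 0 (f := fun x => f (- c - x))).
  by apply: eq_integral => x _; rewrite sub0r opprK addrC.
exact: measurableT_comp (measurable_reflect _).
Qed.

(** The integral runs over the whole line; causality enters through factors extended by 0. *)
Definition convol a b t : R := \int[mu]_x (a (t - x) * b x).

Lemma convolC a b t : measurable_fun setT a -> measurable_fun setT b ->
  convol a b t = convol b a t.
Proof.
move=> ma mb; rewrite /convol /Rintegral; congr fine.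
rewrite -(integral_reflect t).
  by apply: eq_integral => x _ /=; rewrite subKr mulrC.
apply/measurable_EFinP/measurable_funM => //.
exact: measurableT_comp (measurable_reflect _).
Qed.

Lemma measurable_convol_kernel a b :
  measurable_fun setT a -> measurable_fun setT b ->
  measurable_fun setT (fun z : R * R => a (z.1 - z.2) * b z.2).
Proof.
move=> ma mb; apply: measurable_funM; last exact: measurableT_comp.
by apply: measurableT_comp => //; apply: measurable_funB.
Qed.

(** Tonelli makes the integrals of the positive and negative parts of the kernel measurable, and the
    convolution is [fine] of their difference. *)
Lemma measurable_convol a b : measurable_fun setT a -> measurable_fun setT b ->
  measurable_fun setT (convol a b).
Proof.
move=> ma mb.
have := measurable_convol_kernel ma mb.
move=> /measurable_EFinP.
set k : R * R -> \bar R := EFin \o _ => mk.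
have -> : convol a b = fine \o ((fun x => \int[mu]_y k^\+ (x, y)) \-
    (fun x => \int[mu]_y k^\- (x, y)))%E.
  apply/funext => x /=; rewrite /convol /Rintegral integralE /k.
  congr (fine (_ - _)); apply: eq_integral => y _.
    by rewrite !unlock.
  by rewrite !unlock.
apply: measurableT_comp => //; apply: emeasurable_funB.
  by apply: measurable_fun_fubini_tonelli_F => //; exact: measurable_funepos.
by apply: measurable_fun_fubini_tonelli_F => //; exact: measurable_funeneg.
Qed.

Definition L1 a := mu.-integrable setT (EFin \o a).

Lemma L1_measurable a : L1 a -> measurable_fun setT a.
Proof. by move=> /measurable_int/measurable_EFinP. Qed.

Lemma L1D f g : L1 f -> L1 g -> L1 (fun x => f x + g x).
Proof.
move=> lf lg.
have := @integrableD _ (measurableTypeR R) R mu setT measurableT _ _ lf lg.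
exact: eq_integrable.
Qed.

Lemma L1Zl (k : R) f : L1 f -> L1 (fun x => k * f x).
Proof.
move=> lf.
have := @integrableZl _ (measurableTypeR R) R mu setT measurableT k _ lf.
exact: eq_integrable.
Qed.

(** Tonelli: for fixed [y], translation invariance makes the integral of the absolute value over [x]
    equal to [|b y|] times the L1 norm of [a]. *)
Lemma integrable_convol_kernel a b : L1 a -> L1 b ->
  (mu \x mu)%E.-integrable setT
    (fun z : R * R => (a (z.1 - z.2) * b z.2)%:E).
Proof.
move=> ia ib.
have ma := L1_measurable ia; have mb := L1_measurable ib.
have mk := measurable_convol_kernel ma mb.
apply/integrable21ltyP; first exact/measurable_EFinP.
have /integrableP[_ ia_fin] := ia.
have /integrableP[_ ib_fin] := ib.
have na : (\int[mu]_x `|(a x)%:E|)%E \is a fin_num.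
  by rewrite ge0_fin_numE ?integral_ge0.
under eq_integral.
  move=> y _ /=.
  under eq_integral do rewrite normrM EFinM.
  rewrite ge0_integralZr//; last first.
    apply/measurable_EFinP/measurableT_comp => //.
    by apply: measurableT_comp => //; exact: measurable_funB.
  rewrite (integral_translate y (f := fun x => `|(a x)%:E|%E)); last first.
    by apply: measurableT_comp => //; exact/measurable_EFinP.
  over.
rewrite ge0_integralZl//; last first.
- exact: integral_ge0.
- by apply/measurable_EFinP/measurableT_comp.
rewrite lte_mul_pinfty//; exact: integral_ge0.
Qed.

(** By Fubini the inner integral is integrable in [x]. The convolution is its [fine], which turns
    infinite values into 0 and so is dominated by it. *)
Lemma L1_convol a b : L1 a -> L1 b -> L1 (convol a b).
Proof.
move=> ia ib.
have := integrable_fubini_F (integrable_convol_kernel ia ib).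
apply: le_integrable => //.
  apply/measurable_EFinP.
  exact: (measurable_convol (L1_measurable ia) (L1_measurable ib)).
move=> x _ /=; rewrite /convol /Rintegral /fubini_F/=.
by case: (integral _ _ _) => [r||]; rewrite ?lexx//= normr0 leey.
Qed.

Lemma bounded_funT K (M : R) : (forall x, `|K x| <= M) ->
  [bounded K x | x in setT].
Proof.
move=> KM; exists M; split; first exact: num_real.
by move=> N MN x _ /=; rewrite (le_trans (KM x))// ltW.
Qed.

Lemma L1_bounded_mul K (M : R) a : measurable_fun setT K ->
  (forall x, `|K x| <= M) -> L1 a -> L1 (fun x => K x * a x).
Proof.
move=> mK KM ia.
have := @integrableMr _ (measurableTypeR R) R mu setT measurableT _ _ mK
  (bounded_funT KM) ia.
by apply: eq_integrable.
Qed.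

Lemma L1_convol_integrand K (M : R) a t : measurable_fun setT K ->
  (forall x, `|K x| <= M) -> L1 a -> L1 (fun x => K (t - x) * a x).
Proof.
move=> mK KM; apply: (@L1_bounded_mul (fun x => K (t - x)) M) => //.
exact: measurableT_comp (measurable_reflect _).
Qed.

(** A bounded [K] keeps [K (t - x) * a (x - y) * b y] integrable in [x] and [y] for every [t], so
    Fubini gives equality at every point and not only almost everywhere. *)
Lemma convolA K (M : R) a b t : measurable_fun setT K ->
  (forall x, `|K x| <= M) -> L1 a -> L1 b ->
  convol K (convol a b) t = convol (convol K a) b t.
Proof.
move=> mK KM ia ib.
have ma := L1_measurable ia; have mb := L1_measurable ib.
have ik := integrable_convol_kernel ia ib.
have mKt : measurable_fun setT (fun x : R => K (t - x)).
  exact: measurableT_comp (measurable_reflect _).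
have iKk : (mu \x mu)%E.-integrable setT
    (fun z : R * R => (K (t - z.1) * (a (z.1 - z.2) * b z.2))%:E).
  have mK1 : measurable_fun setT (fun z : R * R => K (t - z.1)).
    by apply: (measurableT_comp mKt); exact: measurable_fst.
  have bK1 : [bounded K (t - z.1) | z in [set: R * R]].
    exists M; split; first exact: num_real.
    by move=> N MN z _ /=; rewrite (le_trans (KM _))// ltW.
  have := @integrableMr _ (measurableTypeR R * measurableTypeR R)%type R
    (mu \x mu)%E setT measurableT _ _ mK1 bK1 ik.
  exact: eq_integrable.
have := Fubini iKk => /= FubE.
rewrite /convol /Rintegral; congr fine.
(* [K (t - x)] moves under the inner integral wherever the section in [y] is integrable, which holds
   for almost every [x]. *)
transitivity (\int[mu]_x \int[mu]_y (K (t - x) * (a (x - y) * b y))%R%:E)%E.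
  apply: ae_eq_integral => //.
  - by apply/measurable_EFinP/measurable_funM => //; exact: measurable_convol.
  - exact: measurable_fubini_F iKk.
  - have := ae_integrable1 ik; apply: filterS => x /= ix _.
    under [RHS]eq_integral do rewrite EFinM.
    by rewrite integralZl// EFinM /Rintegral fineK//; exact: integrable_fin_num.
rewrite FubE; apply: eq_integral => v _.
rewrite EFinM /Rintegral.
have iKa : L1 (fun u : R => K (t - v - u) * a u) by exact: L1_convol_integrand.
rewrite fineK; last exact: integrable_fin_num.
rewrite -integralZr//.
rewrite -[RHS](integral_translate v).
  apply: eq_integral => x _; rewrite -EFinM -mulrA.
  by have -> : t - v - (x - v) = t - x by ring.
apply/measurable_EFinP; apply: measurable_funM => //.
exact: L1_measurable iKa.
Qed.

End Convolution.

(** * Injectivity of the Laplace transform *)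

Section Laplace.
Context {R : realType}.
Notation mu := (@lebesgue_measure R).
Implicit Types (a b f g h K : R -> R).

Lemma Rintegral_dominated_cvg (f_ : nat -> R -> R) f g :
  (forall n, measurable_fun setT (f_ n)) -> measurable_fun setT f ->
  {ae mu, forall x, f_ n x @[n --> \oo] --> f x} ->
  L1 g -> (forall n x, `|f_ n x| <= g x) ->
  \int[mu]_x f_ n x @[n --> \oo] --> \int[mu]_x f x.
Proof.
move=> mf_ mf f_f ig f_g.
have [||||i _ cvgf] := @dominated_convergence _ (measurableTypeR R) R mu setT measurableT
  (fun n => EFin \o f_ n) (EFin \o f) (EFin \o g) _ _ _ ig.
- by move=> n; apply/measurable_EFinP; exact: mf_.
- by apply/measurable_EFinP; exact: mf.
- apply: (@filterS _ _ (ae_filter_ringOfSetsType mu) _ _ _ f_f) => x fx _.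
  by apply: cvg_EFin => //; exact: nearW.
- by apply: aeW => x n _ /=; rewrite lee_fin.
apply: fine_cvg; rewrite fineK//; exact: integrable_fin_num.
Qed.

Lemma exp_coeff_sum_le (x : R) m : 0 <= x ->
  \sum_(0 <= k < m) exp_coeff x k <= expR x.
Proof.
move=> x0; rewrite /expR.
apply: (@nondecreasing_cvgn_le _ (series (exp_coeff x))).
  apply: nondecreasing_series => // n _ _.
  exact: exp_coeff_ge0.
exact: is_cvg_series_exp_coeff.
Qed.

(** A bound uniform in [m], meant for dominated convergence: since [k! <= (k+1)!], the term of
    degree [k+1] is at most [y * Y^k / k!] in absolute value. *)
Lemma norm_expR_partial_sum (y Y : R) m : 0 <= y <= Y ->
  `|\sum_(0 <= k < m) exp_coeff (- y) k.+1| <= y * expR Y.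
Proof.
move=> /andP[y0 yY].
apply: (le_trans (ler_norm_sum _ _ _)).
apply: (@le_trans _ _ (y * \sum_(0 <= k < m) exp_coeff Y k)); last first.
  by rewrite ler_wpM2l// exp_coeff_sum_le// (le_trans y0).
rewrite mulr_sumr; apply: ler_sum => k _.
rewrite /exp_coeff/= normrM normrX normrN (ger0_norm y0) exprS -mulrA ler_wpM2l//.
rewrite ger0_norm ?invr_ge0//.
rewrite ler_pM ?exprn_ge0 ?invr_ge0//.
  by rewrite lerXn2r// nnegrE (le_trans y0).
by rewrite lef_pV2 ?posrE ?ltr0n ?fact_gt0// ler_nat factS leq_pmull.
Qed.

(** The value 1 at 0 makes [heav (t - x)] the indicator of the closed half-line [x <= t]. *)
Definition heav (x : R) : R := (0 <= x)%R%:R.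

Lemma heav_ge0 x : 0 <= x -> heav x = 1.
Proof. by rewrite /heav => ->. Qed.

Lemma heav_lt0 x : x < 0 -> heav x = 0.
Proof. by rewrite /heav ltNge => /negbTE ->. Qed.

Lemma measurable_heav : measurable_fun setT heav.
Proof.
have -> : heav = \1_(`[0, +oo[%classic).
  by apply/funext => x; rewrite /heav indicE mem_setE in_itv/= andbT.
exact: measurable_indic.
Qed.

Lemma heav_bounded x : `|heav x| <= 1.
Proof. by rewrite /heav; case: (0 <= x); rewrite ?normr1 ?normr0. Qed.

(** * Uniqueness from the values of the transform at large integers *)

Section Uniqueness.
Variables (h : R -> R) (N : nat).
Hypothesis h0 : forall x, x < 0 -> h x = 0.
Hypothesis ih : forall n, (N <= n)%N -> L1 (fun x => expR (- (n%:R * x)) * h x).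
Hypothesis lh : forall n, (N <= n)%N -> \int[mu]_x (expR (- (n%:R * x)) * h x) = 0.

Lemma measurable_expR_lin (c t : R) : measurable_fun setT (fun x : R => expR (c * (t - x))).
Proof.
apply: measurableT_comp => //; apply: measurable_funM => //.
exact: measurable_funB.
Qed.

Let mh : measurable_fun setT h.
Proof.
have -> : h = (fun x => expR (N%:R * (x - 0)) * (expR (- (N%:R * x)) * h x)).
  by apply/funext => x; rewrite subr0 mulrA -expRD subrr expR0 mul1r.
apply: measurable_funM; last exact: L1_measurable (ih (leqnn N)).
apply: measurableT_comp => //; apply: measurable_funM => //.
exact: measurable_funB.
Qed.

Let ihc n t : (N <= n)%N -> L1 (fun x => expR (n%:R * (t - x)) * h x).
Proof.
move=> Nn.
have := L1Zl (expR (n%:R * t)) (ih Nn).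
apply: eq_integrable => // x _ /=.
by rewrite mulrA -expRD mulrBr.
Qed.

Let lhc n t : (N <= n)%N -> \int[mu]_x (expR (n%:R * (t - x)) * h x) = 0.
Proof.
move=> Nn.
under eq_Rintegral do rewrite mulrBr expRD -mulrA.
by rewrite RintegralZl// ?lh ?mulr0//; exact: ih.
Qed.

(* Phragmen's kernel: expanding 1 - exp(-y) with y = exp(n (t - x)) writes it as
   a series of multiples of exp(-k n x), k >= 1, each orthogonal to h. As n tends
   to infinity it converges to [heav (t - x)], whence [laplace_inj]. *)
Lemma integral_laplace_kernel n t : (0 < n)%N -> (N <= n)%N ->
  \int[mu]_x ((1 - expR (- expR (n%:R * (t - x)))) * h x) = 0.
Proof.
move=> n0 Nn.
pose y x := expR (n%:R * (t - x)).
pose Y := expR (n%:R * t).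
pose s m x := - (\sum_(0 <= k < m) exp_coeff (- y x) k.+1) * h x.
(* [y x ^+ k.+1] is an exponential of frequency [(k+1) n >= N], so the hypotheses on [h] apply to
   every term. *)
have L1s k : L1 (fun x => exp_coeff (- y x) k.+1 * h x) /\
    \int[mu]_x (exp_coeff (- y x) k.+1 * h x) = 0.
  have Nk : (N <= k.+1 * n)%N by rewrite (leq_trans Nn)// leq_pmull.
  have E x : exp_coeff (- y x) k.+1 * h x =
     ((-1) ^+ k.+1 / k.+1`!%:R) * (expR ((k.+1 * n)%:R * (t - x)) * h x).
    have -> : expR ((k.+1 * n)%:R * (t - x)) = y x ^+ k.+1.
      by rewrite natrM -mulrA expRM_natl.
    by rewrite /exp_coeff/= (exprNn (y x)) !mulrA; congr (_ * _); rewrite mulrAC.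
  split.
    have := L1Zl ((-1) ^+ k.+1 / k.+1`!%:R) (ihc t Nk).
    by apply: eq_integrable => // x _ /=; rewrite E.
  under eq_Rintegral do rewrite E.
  by rewrite RintegralZl// ?lhc ?mulr0//; exact: ihc.
have L1S m : L1 (s m) /\ \int[mu]_x s m x = 0.
  rewrite /s; elim: m => [|m [iIH IH]].
    under eq_fun do rewrite big_nil oppr0 mul0r.
    split; first exact: integrable0.
    by rewrite Rintegral_cst// mul0r.
  have [ik k0] := L1s m.
  have E x : - (\sum_(0 <= k < m.+1) exp_coeff (- y x) k.+1) * h x =
     - (\sum_(0 <= k < m) exp_coeff (- y x) k.+1) * h x - exp_coeff (- y x) m.+1 * h x.
    by rewrite big_nat_recr//=; ring.
  split.
    by apply: eq_integrable (integrableB measurableT iIH ik) => // x _ /=; rewrite E.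
  under eq_Rintegral do rewrite E.
  by rewrite RintegralB// IH k0 subrr.
have: \int[mu]_x s m x @[m --> \oo] -->
    \int[mu]_x ((1 - expR (- expR (n%:R * (t - x)))) * h x).
  (* For [x >= 0] one has [y x <= Y], which bounds all partial sums by [y x * expR Y]; for [x < 0]
     the factor [h x] is 0. *)
  apply: (@Rintegral_dominated_cvg _ _ (fun x => expR Y * `|y x * h x|)).
  - by move=> m; exact: L1_measurable (L1S m).1.
  - apply: measurable_funM => //; apply: measurable_funB => //.
    apply: measurableT_comp => //; apply: measurableT_comp => //.
    exact: measurable_expR_lin.
  - apply: aeW => x.
    have -> : (s ^~ x) = (fun m => (1 - series (exp_coeff (- y x)) m.+1) * h x).
      apply/funext => m; rewrite /s /series/= big_nat_recl//=.
      by rewrite /exp_coeff/= expr0 fact0 divr1 opprD addrA subrr add0r.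
    apply: cvgM; last exact: cvg_cst.
    apply: cvgB; first exact: cvg_cst.
    rewrite (cvg_shiftS (series (exp_coeff (- y x)))).
    exact: is_cvg_series_exp_coeff.
  - exact: L1Zl (integrable_norm (ihc t Nn)).
  - move=> m x; have [x0|x0] := ltP x 0.
      by rewrite /s h0// !mulr0 normr0 mulr0.
    rewrite /s !normrM normrN mulrA ler_wpM2r// mulrC.
    rewrite (ger0_norm (expR_ge0 _)) norm_expR_partial_sum// expR_ge0 ler_expR.
    by rewrite ler_wpM2l// gerBl.
have -> : (fun m => \int[mu]_x s m x) = cst 0 by apply/funext => m; exact: (L1S m).2.
by move=> /cvg_unique; apply => //; exact: cvg_cst.
Qed.

Lemma laplace_inj t : convol heav h t = 0.
Proof.
(* This shift makes every frequency [n + M] positive and at least [N]. *)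
pose M := N.+1.
have NM n : (N <= n + M)%N by rewrite /M addnS -addSn (leq_trans _ (leq_addl _ _)).
have: \int[mu]_x ((1 - expR (- expR ((n + M)%:R * (t - x)))) * h x) @[n --> \oo]
    --> \int[mu]_x (heav (t - x) * h x).
  apply: (@Rintegral_dominated_cvg _ _ (fun x => `|expR (M%:R * (t - x)) * h x|)).
  - move=> n; apply: measurable_funM => //; apply: measurable_funB => //.
    apply: measurableT_comp => //; apply: measurableT_comp => //.
    exact: measurable_expR_lin.
  - apply: measurable_funM => //.
    exact: measurableT_comp measurable_heav (measurable_reflect _).
  (* At [x = t] the kernel is constantly [1 - expR (-1)], whereas [heav 0 = 1]; this single point is
     null. *)
  - exists [set t]; split => //; first exact: lebesgue_measure_set1.
    move=> x /= ncvg; apply: contrapT => /eqP xt; apply: ncvg.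
    apply: cvgM; last exact: cvg_cst.
    move: xt; rewrite neq_lt => /orP[xt|tx].
    + have -> : heav (t - x) = 1 - 0 by rewrite /heav subr_ge0 ltW// subr0.
      apply: cvgB; first exact: cvg_cst.
      apply: (@squeeze_cvgr _ _ _ _ (cst 0) (fun n => expR (- (t - x)) ^+ n)).
      (* With [z = (n + M) (t - x)], the chain [expR z >= 1 + z >= n (t - x)] bounds the error by a
         geometric sequence. *)
      * apply: nearW => n; rewrite expR_ge0/= -expRM_natl ler_expR mulrN lerN2.
        apply: (@le_trans _ _ ((n + M)%:R * (t - x))).
          by apply: ler_wpM2r; [rewrite subr_ge0 ltW|rewrite ler_nat leq_addr].
        by rewrite (le_trans _ (expR_ge1Dx _))// lerDr.
      * exact: cvg_cst.
      * apply: cvg_expr; rewrite ger0_norm ?expR_ge0// expR_lt1 oppr_lt0.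
        by rewrite subr_gt0.
    + have -> : heav (t - x) = 1 - expR (- 0).
        by rewrite oppr0 expR0 subrr /heav subr_ge0 leNgt tx.
      apply: cvgB; first exact: cvg_cst.
      apply: continuous_cvg; first exact: continuous_expR.
      apply: cvgN.
      have : expR (t - x) ^+ n @[n --> \oo] --> 0.
        apply: cvg_expr; rewrite ger0_norm ?expR_ge0// expR_lt1.
        by rewrite subr_lt0.
      rewrite -(cvg_shiftn M) => cvg0.
      by under eq_fun do rewrite expRM_natl.
  - exact: integrable_norm (ihc t (NM 0%N)).
  - move=> n x; rewrite !normrM ler_wpM2r//.
    rewrite (ger0_norm (expR_ge0 _)) ger0_norm; last first.
      by rewrite subr_ge0 expR_le1 oppr_le0 expR_ge0.
    (* For [x <= t] the kernel is at most 1 and the exponential at least 1; for [x > t],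
       [1 - expR (- u) <= u] and the exponential decreases with the frequency. *)
    have [xt|tx] := leP x t.
      apply: (@le_trans _ _ 1); first by rewrite gerBl expR_ge0.
      by rewrite -expR0 ler_expR mulr_ge0// subr_ge0.
    apply: (@le_trans _ _ (expR ((n + M)%:R * (t - x)))).
      by rewrite lerBlDr -lerBlDl; 
        have := expR_ge1Dx (- expR ((n + M)%:R * (t - x))); lra.
    rewrite ler_expR; apply: ler_wnM2r; first by rewrite subr_le0 ltW.
    by rewrite ler_nat leq_addl.
have -> : (fun n => \int[mu]_x ((1 - expR (- expR ((n + M)%:R * (t - x)))) * h x)) = cst 0.
  by apply/funext => n; rewrite integral_laplace_kernel// addn_gt0 orbT.
by move=> /cvg_unique; apply => //; exact: cvg_cst.
Qed.

End Uniqueness.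
End Laplace.

(** * Vanishing primitives, continuity of convolutions, and clipped extensions *)

Section Primitive.
Context {R : realType}.
Notation mu := (@lebesgue_measure R).
Implicit Types (a b d f g h K : R -> R).

Lemma convol_heavE d t : convol heav d t = \int[mu]_(x in `]-oo, t]) d x.
Proof.
rewrite Rintegral_mkcond; apply: eq_Rintegral => x _.
rewrite patchE mem_setE in_itv/= /heav subr_ge0.
by case: ifP; rewrite ?mul1r ?mul0r.
Qed.

Lemma L1_Nyc d t : L1 d -> mu.-integrable `]-oo, t] (EFin \o d).
Proof. by move=> id; apply: integrableS id. Qed.

(** Lebesgue differentiation: almost everywhere [d] is the derivative of its primitive, here the
    constant 0. *)
Lemma primitive_eq0_ae d : L1 d -> (forall t, convol heav d t = 0) ->
  {ae mu, forall x, d x = 0}.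
Proof.
move=> id d0.
have ld : locally_integrable setT d.
  by apply: open_integrable_locally => //; exact: openT.
have /= := FTC1Ny (fun y => L1_Nyc y id) ld.
have -> : (fun x => \int[mu]_(t in `]-oo, x]) d t) = cst 0.
  by apply/funext => x; rewrite -convol_heavE d0.
apply: filterS; first exact: (ae_filter_ringOfSetsType mu).
by move=> x [_ <-]; rewrite derive1_cst.
Qed.

Lemma continuous_primitive_eq0 d t : L1 d -> (forall t, convol heav d t = 0) ->
  {for t, continuous d} -> d t = 0.
Proof.
move=> id d0 ct.
have t1 : t < t + 1 by rewrite ltrDl.
have [|_ <-] := continuous_FTC1 t1 (L1_Nyc (t + 1) id) _ ct; first by rewrite ltNyr.
have -> : (fun x => \int[mu]_(t in `]-oo, x]) d t) = cst 0.
  by apply/funext => x; rewrite -convol_heavE d0.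
by rewrite derive1_cst.
Qed.

Lemma convol_primitive_eq0 K d t : measurable_fun setT K -> L1 d ->
  (forall t, convol heav d t = 0) -> convol K d t = 0.
Proof.
move=> mK id d0; rewrite /convol /Rintegral.
rewrite (ae_eq_integral (cst 0%E)) ?integral0//.
  apply/measurable_EFinP; apply: measurable_funM; last exact: L1_measurable.
  exact: measurableT_comp mK (measurable_reflect _).
have := primitive_eq0_ae id d0.
apply: filterS; first exact: (ae_filter_ringOfSetsType mu).
by move=> x /= -> _; rewrite mulr0.
Qed.

(** The kernel may jump at 0, as causal kernels do: the jump disturbs the integrand only at [x = t],
    a null set. The dominating function is [M * |b x|]. *)
Lemma continuous_convol K (M : R) b : measurable_fun setT K ->
  (forall x, `|K x| <= M) -> (forall x, x != 0 -> {for x, continuous K}) ->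
  L1 b -> continuous (convol K b).
Proof.
move=> mK KM cK ib t.
have mb := L1_measurable ib.
have mKr s : measurable_fun setT (fun x : R => K (s - x)).
  exact: measurableT_comp mK (measurable_reflect _).
apply/(@cvg_nbhsP _ R^o) => u ut.
apply: (@Rintegral_dominated_cvg _ _ _ (fun x => M * `|b x|)).
- by move=> n; exact: measurable_funM.
- exact: measurable_funM.
- exists [set t]; split => //; first exact: lebesgue_measure_set1.
  move=> x /= ncvg; apply: contrapT => /eqP xt; apply: ncvg.
  apply: cvgM; last exact: cvg_cst.
  apply: (@cvg_comp _ _ _ (fun n => u n - x) K _ (nbhs (t - x))).
    by apply: cvgB => //; exact: cvg_cst.
  by apply: cK; rewrite subr_eq0 eq_sym.
- exact: L1Zl (integrable_norm ib).
- by move=> n x; rewrite normrM ler_wpM2r.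
Qed.

(* Composing with [clip T] extends a function continuous on [0, T] to one that
   is continuous and bounded on the whole line. *)
Definition clip (T x : R) : R := Num.max 0 (Num.min T x).

Lemma clip_itv T x : 0 <= T -> 0 <= clip T x <= T.
Proof. by move=> T0; rewrite /clip le_max lexx/= ge_max T0 ge_min lexx. Qed.

Lemma clip_id T x : 0 <= x <= T -> clip T x = x.
Proof. by move=> /andP[x0 xT]; rewrite /clip (min_idPr xT) (max_idPr x0). Qed.

Lemma continuous_clip T : continuous (clip T).
Proof.
move=> x; apply: (@continuous_max R R^o (cst 0) (fun x => Num.min T x)).
  exact: cvg_cst.
apply: (@continuous_min R R^o (cst T) id); first exact: cvg_cst.
exact: cvg_id.
Qed.

Lemma continuous_comp_clip T f : 0 <= T -> {within `[0, T], continuous f} ->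
  continuous (f \o clip T).
Proof.
move=> T0 /subspace_continuousP cf x.
have clipx : `[0, T]%classic (clip T x) by rewrite /= in_itv/=; exact: clip_itv.
apply: cvg_comp (cf _ clipx).
move=> A; rewrite /within/= => nA.
have := continuous_clip nA.
rewrite nbhs_simpl/=; apply: filterS => y /=.
by apply; rewrite in_itv/=; exact: clip_itv.
Qed.

Lemma bounded_comp_clip T f : 0 <= T -> {within `[0, T], continuous f} ->
  exists M, forall x, `|(f \o clip T) x| <= M.
Proof.
move=> T0 cf.
have cnf : {within `[0, T], continuous (Num.norm \o (f \o clip T))}.
  apply: continuous_subspaceT => x; apply: continuous_comp.
    exact: continuous_comp_clip.
  exact: norm_continuous.
have [c _ cM] := EVT_max T0 cnf.
(* [clip] maps the line into [[0, T]] and fixes that interval, so the maximum over [[0, T]] bounds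
   every value. *)
exists `|(f \o clip T) c| => x.
have := cM (clip T x); rewrite in_itv/= clip_itv// => /(_ isT) /=.
by rewrite [clip T (clip T x)]clip_id ?clip_itv.
Qed.

End Primitive.

(** * Laplace transforms of causal functions and of convolutions *)

Section LaplaceConvolution.
Context {R : realType}.
Notation mu := (@lebesgue_measure R).
Implicit Types (a b d f g h K phi psi : R -> R).

Lemma L1_patch (A : set (measurableTypeR R)) f : measurable A ->
  mu.-integrable A (EFin \o f) -> L1 (f \_ A).
Proof.
move=> mA /(integrable_mkcond _ mA).
by rewrite restrict_EFin.
Qed.

(* Integration over the line is convolution with the constant 1. *)
Lemma Rintegral_convol a b : L1 a -> L1 b ->
  \int[mu]_x convol a b x = (\int[mu]_x a x) * (\int[mu]_x b x).
Proof.
move=> ia ib.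
have E f : \int[mu]_x f x = convol (cst 1) f 0.
  by rewrite /convol; under [RHS]eq_Rintegral do rewrite mul1r.
rewrite E (@convolA _ _ 1)//; last by move=> x; rewrite normr1.
rewrite {1}/convol -RintegralZl//; apply: eq_Rintegral => x _.
by rewrite /convol; under eq_Rintegral do rewrite mul1r.
Qed.

Lemma laplace_patchE g s x :
  (laplace_integrand g s \_ `[0, +oo[) x = expR (- (s * x)) * (g \_ `[0, +oo[) x.
Proof. by rewrite !patchE; case: ifP => // _; rewrite mulr0. Qed.

Lemma laplaceE g s :
  laplace g s = \int[mu]_x (expR (- (s * x)) * (g \_ `[0, +oo[) x).
Proof.
rewrite /laplace Rintegral_mkcond; apply: eq_Rintegral => x _.
exact: laplace_patchE.
Qed.

Lemma has_laplaceP g s : has_laplace g s ->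
  L1 (fun x => expR (- (s * x)) * (g \_ `[0, +oo[) x).
Proof.
move=> /L1_patch => /(_ (measurable_itv _)).
by apply: eq_integrable => // x _ /=; rewrite laplace_patchE.
Qed.

(** The weight is multiplicative, [exp(-s x) = exp(-s (x - y)) exp(-s y)], so the transform of a
    convolution becomes a plain integral covered by [Rintegral_convol]. *)
Lemma convol_expR s a b (M : R) x :
  measurable_fun setT (fun y : R => expR (- (s * y)) * a y) ->
  (forall y, `|expR (- (s * y)) * a y| <= M) ->
  L1 (fun y => expR (- (s * y)) * b y) ->
  convol (fun y => expR (- (s * y)) * a y) (fun y => expR (- (s * y)) * b y) x
  = expR (- (s * x)) * convol a b x.
Proof.
move=> ma aM ib.
have E y : a (x - y) * b y = expR (s * x) *
    ((expR (- (s * (x - y))) * a (x - y)) * (expR (- (s * y)) * b y)).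
  have -> : expR (- (s * (x - y))) = expR (- (s * x)) * expR (s * y).
    by rewrite -expRD; congr expR; ring.
  rewrite [RHS](_ : _ = (expR (s * x) * expR (- (s * x))) * (expR (s * y) * expR (- (s * y)))
     * (a (x - y) * b y)); last by ring.
  by rewrite !expRxMexpNx_1 !mul1r.
rewrite [in RHS]/convol.
under [in RHS]eq_Rintegral do rewrite E.
rewrite RintegralZl//; last exact: (L1_convol_integrand x ma aM ib).
by rewrite mulrA [X in _ = X * _]mulrC expRxMexpNx_1 mul1r.
Qed.

(** The exponential density has mass 1, which yields the transform [s^-1] of [heav]. *)
Lemma exponential_pdf_heav (s x : R) : 0 < s ->
  expR (- (s * x)) * heav x = s^-1 * exponential_pdf s x.
Proof.
move=> s0; rewrite /exponential_pdf patchE mem_setE in_itv/= andbT /heav.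
case: ifP => _; last by rewrite !mulr0.
by rewrite mulr1 mulrA mulVf ?mul1r ?mulNr// gt_eqF.
Qed.

Lemma L1_expR_heav (s : R) : 0 < s -> L1 (fun x => expR (- (s * x)) * heav x).
Proof.
move=> s0; apply: eq_integrable (L1Zl s^-1 (integrable_exponential_pdf s0)) => //.
by move=> x _ /=; rewrite exponential_pdf_heav.
Qed.

Lemma Rintegral_expR_heav (s : R) : 0 < s ->
  \int[mu]_x (expR (- (s * x)) * heav x) = s^-1.
Proof.
move=> s0; under eq_Rintegral do rewrite exponential_pdf_heav//.
rewrite RintegralZl//; last exact: integrable_exponential_pdf.
by rewrite /Rintegral integral_exponential_pdf// mulr1.
Qed.

(** Dominated convergence, with the integrand at [N] as bound; the limit is 0 off the null point
    [x = 0]. This later excludes zeros of the transform of [phi]. *)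
Lemma laplace_cvg0 g N : (forall n, (N <= n)%N -> has_laplace g n%:R) ->
  laplace g n%:R @[n --> \oo] --> 0.
Proof.
move=> lg.
have NN n : (N <= n + N)%N by rewrite leq_addl.
suff : \int[mu]_x (expR (- ((n + N)%:R * x)) * (g \_ `[0, +oo[) x) @[n --> \oo]
    --> \int[mu]_x (0 : R).
  rewrite Rintegral_cst// mul0r => cvg0.
  rewrite -(cvg_shiftn N)/=.
  by under eq_fun do rewrite laplaceE.
apply: (@Rintegral_dominated_cvg _ _ _ (fun x => `|expR (- (N%:R * x)) * (g \_ `[0, +oo[) x|)).
- by move=> n; exact: L1_measurable (has_laplaceP (lg _ (NN n))).
- exact: measurable_cst.
- exists [set 0]; split => //; first exact: lebesgue_measure_set1.
  move=> x /= ncvg; apply: contrapT => /eqP xt; apply: ncvg.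
  rewrite patchE mem_setE in_itv/= andbT; case: ifPn => [x0|_]; last first.
    by under eq_fun do rewrite mulr0; exact: cvg_cst.
  rewrite -[X in _ --> X](mul0r (g x)).
  apply: cvgM; last exact: cvg_cst.
  have : expR (- x) ^+ n @[n --> \oo] --> 0.
    apply: cvg_expr; rewrite ger0_norm ?expR_ge0// expR_lt1 oppr_lt0.
    by rewrite lt_neqAle x0 eq_sym xt.
  rewrite -(cvg_shiftn N) => cvg0.
  by under eq_fun do rewrite -mulrN expRM_natl.
- exact: integrable_norm (has_laplaceP (lg _ (leqnn N))).
- move=> n x; rewrite patchE mem_setE in_itv/= andbT; case: ifPn => [x0|_]; last first.
    by rewrite !mulr0 normr0.
  rewrite !normrM ler_wpM2r// !ger0_norm ?expR_ge0// ler_expR lerN2.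
  by apply: ler_wpM2r => //; rewrite ler_nat leq_addl.
Qed.

End LaplaceConvolution.

(** * The Volterra identity *)

Section Volterra.
Context {R : realType}.
Notation mu := (@lebesgue_measure R).
Variables (T : R) (phi psi : R -> R).
Hypothesis T_gt0 : 0 < T.
Hypothesis phi_cont : {within `[0, T], continuous phi}.
Hypothesis psi_loc : loc_integrable_halfline psi.

Notation Phi := (phi \_ `[0, T]).
Notation Psi := (psi \_ `[0, T]).
Notation Psi0 := (psi \_ `[0, +oo[).

(** Separates the possible jumps of [Phi] at [T] and at 0 from a continuous factor. *)
Lemma PhiE x : Phi x = heav (T - x) * (heav x * (phi \o clip T) x).
Proof.
rewrite patchE mem_setE in_itv/= /heav subr_ge0.
case: (leP 0 x) => x0; last by rewrite mul0r mulr0.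
case: (leP x T) => xT; last by rewrite mul0r.
by rewrite !mul1r clip_id// x0.
Qed.

Lemma phi_clip_heav_bounded : exists M, forall x, `|heav x * (phi \o clip T) x| <= M.
Proof.
have [M phiM] := bounded_comp_clip (ltW T_gt0) phi_cont.
exists M => x; rewrite normrM (le_trans _ (phiM x))// ler_piMl// heav_bounded//.
Qed.

Lemma Phi_bounded : exists M, forall x, `|Phi x| <= M.
Proof.
have [M phiM] := phi_clip_heav_bounded.
exists M => x; rewrite PhiE normrM (le_trans _ (phiM x))// ler_piMl// heav_bounded//.
Qed.

Lemma L1_Phi : L1 Phi.
Proof.
apply: L1_patch => //; apply: continuous_compact_integrable => //.
exact: segment_compact.
Qed.

Lemma L1_Psi : L1 Psi.
Proof. by apply: L1_patch => //; exact: psi_loc. Qed.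

Lemma measurable_phi_clip_heav :
  measurable_fun setT (fun x => heav x * (phi \o clip T) x).
Proof.
apply: measurable_funM; first exact: measurable_heav.
apply: continuous_measurable_fun; exact: continuous_comp_clip (ltW T_gt0) phi_cont.
Qed.

(** [Psi] lives on [x >= 0], so only kernel arguments [t - x <= T] occur and the cut-off at [T] is
    not seen. *)
Lemma convol_Phi_clip t : 0 <= t <= T ->
  convol (fun x => heav x * (phi \o clip T) x) Psi t = convol Phi Psi t.
Proof.
move=> /andP[t0 tT]; apply: eq_Rintegral => x _.
rewrite PhiE patchE mem_setE in_itv/=; case: ifPn => [/andP[x0 xT]|]; last by rewrite !mulr0.
by rewrite (@heav_ge0 _ (T - _)) ?mul1r//; lra.
Qed.

(** For [x > T] the argument [t - x] is negative, where [Phi] vanishes. *)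
Lemma convol_Phi_Psi0 t : t <= T -> convol Phi Psi0 t = convol Phi Psi t.
Proof.
move=> tT; apply: eq_Rintegral => x _.
rewrite !patchE !mem_setE !in_itv/= !andbT.
case: (leP 0 x) => //= x0; case: (leP x T) => //= xT.
by rewrite ifF ?mul0r//; apply/negP => /andP[]; lra.
Qed.

Hypothesis phi0_neq0 : phi 0 != 0.

(* The function that [volterra] shows to vanish on [0, T]. *)
Let h x := convol Phi Psi0 x + (phi 0)^-1 * Phi x - heav x.

(** A continuous function on the line that agrees with [h] on [[0, T]]: the kernel keeps only its
    jump at 0, which [continuous_convol] permits, and [heav] is replaced by 1. *)
Lemma continuous_residual :
  continuous (fun t => convol (fun x => heav x * (phi \o clip T) x) Psi t +
     (phi 0)^-1 * (phi \o clip T) t - 1).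
Proof.
have [M phiM] := phi_clip_heav_bounded.
have cphi := continuous_comp_clip (ltW T_gt0) phi_cont.
move=> t; apply: cvgB; last exact: cvg_cst.
apply: cvgD; last by apply: cvgM; [exact: cvg_cst|exact: cphi].
apply: (continuous_convol measurable_phi_clip_heav phiM _ L1_Psi).
move=> x x0; apply: cvgM; last exact: cphi.
move: x0; rewrite neq_lt => /orP[x0|x0].
  rewrite (heav_lt0 x0).
  apply: cvg_near_cst; near=> y; apply: heav_lt0; near: y; exact: lt_nbhsl.
rewrite (heav_ge0 (ltW x0)).
apply: cvg_near_cst; near=> y; apply: heav_ge0; apply: ltW; near: y; exact: lt_nbhsr.
Unshelve. all: by end_near. Qed.

Lemma residualE t : 0 <= t <= T -> convol (fun x => heav x * (phi \o clip T) x) Psi t +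
     (phi 0)^-1 * (phi \o clip T) t - 1 = h t.
Proof.
move=> t0T; rewrite convol_Phi_clip// /h convol_Phi_Psi0 ?(andP t0T).2//.
rewrite PhiE /heav subr_ge0 (andP t0T).1 (andP t0T).2 !mul1r//.
Qed.

Lemma residual_lt0 x : x < 0 -> h x = 0.
Proof.
move=> x0; rewrite /h PhiE !(heav_lt0 x0) mul0r !mulr0 subr0 addr0.
transitivity (\int[mu]_(x in setT) (0 : R)); last by rewrite Rintegral_cst// mul0r.
apply: eq_Rintegral => y _.
rewrite PhiE patchE mem_setE in_itv/= andbT.
case: (leP 0 y) => y0; last by rewrite mulr0.
by rewrite (@heav_lt0 _ (x - y)) ?mul0r ?mulr0 ?mul0r//; lra.
Qed.

Section Laplace_residual.
Variable s : R.
Hypothesis s0 : 0 < s.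
Hypothesis psis : has_laplace psi s.

Let E x := expR (- (s * x)).

Let LPsi0 : L1 (fun x => E x * Psi0 x).
Proof. exact: has_laplaceP. Qed.

(** The inserted [heav] makes the weight bounded by 1, since [s > 0]. *)
Let EPhiE x : E x * Phi x = (E x * heav x) * Phi x.
Proof.
rewrite -mulrA; congr (_ * _); rewrite PhiE /heav.
by case: (0 <= x); rewrite ?mul1r// !(mul0r, mulr0).
Qed.

Let mEheav : measurable_fun setT (fun x => E x * heav x).
Proof. exact: L1_measurable (L1_expR_heav s0). Qed.

Let Eheav_bounded x : `|E x * heav x| <= 1.
Proof.
rewrite /heav; case: (leP 0 x) => x0; last by rewrite mulr0 normr0.
by rewrite mulr1 ger0_norm ?expR_ge0// expR_le1 oppr_le0 mulr_ge0// ltW.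
Qed.

Let LPhi : L1 (fun x => E x * Phi x).
Proof.
under eq_fun do rewrite EPhiE.
exact: (L1_bounded_mul mEheav Eheav_bounded L1_Phi).
Qed.

Let EhE x : E x * h x = convol (fun x => E x * Phi x) (fun x => E x * Psi0 x) x +
  (phi 0)^-1 * (E x * Phi x) + (-1) * (E x * heav x).
Proof.
have [M PhiM] := Phi_bounded.
rewrite (@convol_expR _ _ _ _ M) //; last 2 first.
- exact: L1_measurable LPhi.
- move=> y; rewrite -/(E y) EPhiE normrM (le_trans _ (PhiM y))// ler_piMl// Eheav_bounded//.
by rewrite /h -/(E x); ring.
Qed.

Lemma L1_laplace_residual : L1 (fun x => E x * h x).
Proof.
under eq_fun do rewrite EhE.
apply: L1D; last exact: L1Zl (L1_expR_heav s0).
by apply: L1D; [exact: L1_convol|exact: L1Zl].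
Qed.

Lemma laplace_zero_ext : laplace (zero_ext T phi) s = \int[mu]_x (E x * Phi x).
Proof.
rewrite laplaceE; apply: eq_Rintegral => x _; congr (_ * _).
rewrite !patchE !mem_setE !in_itv/= andbT /zero_ext.
by case: (0 <= x) => //=.
Qed.

(** By [EhE] the transform of [h] is that of [phi] times that of [psi], plus that of [phi] over
    [phi 0], minus [1 / s]; the formula for [psi] makes this 0. *)
Lemma laplace_residual : laplace (zero_ext T phi) s != 0 ->
  laplace psi s = 1 / (s * laplace (zero_ext T phi) s) - 1 / phi 0 ->
  \int[mu]_x (E x * h x) = 0.
Proof.
move=> phis0 psisE.
under eq_Rintegral do rewrite EhE.
have LEh := L1_expR_heav s0.
have LC := L1_convol LPhi LPsi0.
rewrite RintegralD//; last 2 first.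
- by apply: L1D => //; exact: L1Zl.
- exact: L1Zl.
rewrite RintegralD//; last exact: L1Zl.
rewrite !RintegralZl// Rintegral_convol// Rintegral_expR_heav// -laplace_zero_ext.
rewrite -laplaceE psisE; field.
by rewrite phis0 phi0_neq0 gt_eqF.
Qed.

End Laplace_residual.

Hypothesis psi_laplace : \forall s \near +oo,
     has_laplace psi s /\
     laplace psi s = 1 / (s * laplace (zero_ext T phi) s) - 1 / phi 0.

Lemma laplace_residual_nat : exists N, forall n, (N <= n)%N ->
  L1 (fun x => expR (- (n%:R * x)) * h x) /\
  \int[mu]_x (expR (- (n%:R * x)) * h x) = 0.
Proof.
have [N0 _ HN0] : \forall n \near \oo, has_laplace psi n%:R /\
  laplace psi n%:R = 1 / (n%:R * laplace (zero_ext T phi) n%:R) - 1 / phi 0.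
  exact: (cvgr_idn psi_laplace).
have cvg0 : laplace psi n%:R @[n --> \oo] --> 0.
  by apply: (@laplace_cvg0 _ _ N0) => n /HN0[].
have [N1 _ HN1] : \forall n \near \oo, `|0 - laplace psi n%:R| < `|(phi 0)^-1|.
  by move/cvgrPdist_lt : cvg0; apply; rewrite normr_gt0 invr_neq0.
exists (maxn 1 (maxn N0 N1)) => n; rewrite !geq_max => /and3P[n1 nN0 nN1].
have [psin psinE] := HN0 _ nN0.
have n0 : 0 < n%:R :> R by rewrite ltr0n.
split; first exact: L1_laplace_residual.
apply: laplace_residual => //.
(* Division by 0 gives 0, so a zero of the transform of [phi] at [n] would turn the hypothesis into
   [laplace psi n = - 1 / phi 0], against the bound chosen for [N1]. *)
apply/eqP => phin0; have := HN1 _ nN1.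
by rewrite /= psinE phin0 mulr0 invr0 mulr0 !sub0r opprK div1r ltxx.
Qed.

(** [laplace_inj] makes every primitive of [h] vanish. Near an interior point [h] is the continuous
    residual, so its value there is 0 as well. *)
Lemma residual_eq0 t : 0 < t < T -> h t = 0.
Proof.
move=> /andP[t0 tT].
have [N HN] := laplace_residual_nat.
have inj := laplace_inj residual_lt0 (fun n Nn => (HN n Nn).1) (fun n Nn => (HN n Nn).2).
(* Integrability is known for [h] with an exponential weight; after truncation at [T] the inverse
   weight is bounded by [expR (N * T)]. *)
pose hT x := heav (T - x) * h x.
have LhT : L1 hT.
  have LEh := (HN N (leqnn N)).1.
  have -> : hT = (fun x => (expR (N%:R * x) * (heav (T - x) * heav x)) *
      (expR (- (N%:R * x)) * h x)).
    apply/funext => x; rewrite /hT.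
    case: (leP 0 x) => x0; last by rewrite residual_lt0// !mulr0.
    rewrite [heav x]/heav x0 mulr1 mulrACA expRxMexpNx_1 mul1r//.
  apply: (@L1_bounded_mul _ _ (expR (N%:R * T))) => //.
    apply: measurable_funM.
      by apply: measurableT_comp => //; exact: measurable_funM.
    apply: measurable_funM; last exact: measurable_heav.
    exact: measurableT_comp measurable_heav (measurable_reflect _).
  move=> x; rewrite /heav subr_ge0.
  case: (leP x T) => xT; last by rewrite mul0r mulr0 normr0 expR_ge0.
  case: (leP 0 x) => x0; last by rewrite !mulr0 normr0 expR_ge0.
  by rewrite !mulr1 ger0_norm ?expR_ge0// ler_expR ler_wpM2l.
have hT0 y : convol heav hT y = 0.
  (* The primitive of [hT] at [y] is that of [h] at [min T y]. *)
  rewrite -(inj (Num.min T y)); apply: eq_Rintegral => x _.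
  rewrite /hT mulrA /heav !subr_ge0 le_min.
  by case: (x <= T); case: (x <= y); rewrite /= !(mulr1, mul1r, mul0r, mulr0).
have hTE : hT t = h t by rewrite /hT /heav subr_ge0 ltW// mul1r.
rewrite -hTE; apply: continuous_primitive_eq0 => //.
have := @continuous_residual t.
rewrite /continuous_at residualE ?ltW// -hTE.
apply: cvg_trans; apply: near_eq_cvg; near=> y.
have y0 : 0 < y by near: y; exact: lt_nbhsr.
have yT : y < T by near: y; exact: lt_nbhsl.
by rewrite residualE ?ltW// /hT /heav subr_ge0 ltW// mul1r.
Unshelve. all: by end_near. Qed.

(** The identity holds on the open interval by [residual_eq0] and reaches both endpoints as
    one-sided limits of the continuous residual. *)
Lemma volterra t : 0 <= t <= T -> convol Phi Psi t = 1 - phi t / phi 0.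
Proof.
move=> t0T.
pose r t := convol (fun x => heav x * (phi \o clip T) x) Psi t +
     (phi 0)^-1 * (phi \o clip T) t - 1.
suff : r t = 0.
  by rewrite /r convol_Phi_clip//= clip_id// => rt0; lra.
have r0 x : 0 < x < T -> r x = 0.
  move=> x0T; rewrite /r residualE ?residual_eq0//.
  by case/andP: x0T => /ltW -> /ltW ->.
have cr : continuous r := continuous_residual.
move: t0T => /andP[].
rewrite le_eqVlt => /predU1P[<- _|t0].
  apply/esym; apply: (@cvg_unique _ _ (r x @[x --> 0^'+])) => //.
    apply: cvg_near_cst; near=> x; apply: r0; apply/andP; split.
      by near: x; exact: nbhs_right_gt.
    by near: x; exact: nbhs_right_lt.
  exact: cvg_at_right_filter (cr 0).
rewrite le_eqVlt => /predU1P[->|tT]; last by rewrite r0// t0.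
apply/esym; apply: (@cvg_unique _ _ (r x @[x --> T^'-])) => //.
  apply: cvg_near_cst; near=> x; apply: r0; apply/andP; split.
    by near: x; exact: nbhs_left_gt.
  by near: x; exact: nbhs_left_lt.
exact: cvg_at_left_filter (cr T).
Unshelve. all: by end_near. Qed.

End Volterra.

(** * Causal convolutions and absolutely continuous functions *)

Section Causal.
Context {R : realType}.
Notation mu := (@lebesgue_measure R).
Implicit Types (a b d f g h K : R -> R).

Lemma patch_itv_lt0 (T : R) f x : x < 0 -> (f \_ `[0, T]) x = 0.
Proof. by move=> x0; rewrite patchE mem_setE in_itv/= leNgt x0. Qed.

Lemma patch_itv_id (T : R) f x : 0 <= x <= T -> (f \_ `[0, T]) x = f x.
Proof. by move=> x0T; rewrite patchE mem_setE in_itv/= x0T. Qed.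

Lemma convol_lt0 a b x : (forall y, y < 0 -> a y = 0) ->
  (forall y, y < 0 -> b y = 0) -> x < 0 -> convol a b x = 0.
Proof.
move=> a0 b0 x0; transitivity (\int[mu]_(x in setT) (0 : R)).
  apply: eq_Rintegral => y _; case: (ltP y 0) => y0; first by rewrite b0 ?mulr0.
  by rewrite a0 ?mul0r//; lra.
by rewrite Rintegral_cst// mul0r.
Qed.

Lemma convol_itv a b x : (forall y, y < 0 -> a y = 0) ->
  (forall y, y < 0 -> b y = 0) -> convol a b x = \int[mu]_(y in `[0, x]) (a (x - y) * b y).
Proof.
move=> a0 b0; rewrite [RHS]Rintegral_mkcond; apply: eq_Rintegral => y _.
rewrite patchE mem_setE in_itv/=; case: (ltP y 0) => y0; first by rewrite b0 ?mulr0.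
by case: (leP y x) => //= yx; rewrite a0 ?mul0r//; lra.
Qed.

Lemma convol_patch T a b x : x <= T ->
  convol (a \_ `[0, T]) (b \_ `[0, T]) x = \int[mu]_(y in `[0, x]) (a (x - y) * b y).
Proof.
move=> xT; rewrite convol_itv; try exact: patch_itv_lt0.
apply: eq_Rintegral => y; rewrite inE/= in_itv/= => /andP[y0 yx].
by rewrite !patch_itv_id//; lra.
Qed.

Lemma convol_heav_itv b x : (forall y, y < 0 -> b y = 0) ->
  convol heav b x = \int[mu]_(y in `[0, x]) b y.
Proof.
move=> b0; rewrite convol_itv//; last exact: heav_lt0.
apply: eq_Rintegral => y; rewrite inE/= in_itv/= => /andP[y0 yx].
by rewrite heav_ge0 ?mul1r// subr_ge0.
Qed.

Lemma convol_heav_patch T b x : x <= T ->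
  convol heav (b \_ `[0, T]) x = \int[mu]_(y in `[0, x]) b y.
Proof.
move=> xT; rewrite convol_heav_itv; last exact: patch_itv_lt0.
apply: eq_Rintegral => y; rewrite inE/= in_itv/= => /andP[y0 yx].
by rewrite patch_itv_id ?y0 ?(le_trans yx).
Qed.

(** Lets a convolution serve in turn as a bounded kernel. *)
Lemma convol_bounded K (M : R) a : measurable_fun setT K ->
  (forall x, `|K x| <= M) -> L1 a ->
  exists M', forall t, `|convol K a t| <= M'.
Proof.
move=> mK KM ia; exists (\int[mu]_x (M * `|a x|)) => t.
have iKa := L1_convol_integrand t mK KM ia.
apply: (le_trans (le_normr_Rintegral measurableT iKa)).
apply: le_Rintegral => //.
- exact: integrable_norm iKa.
- exact: L1Zl (integrable_norm ia).
- by move=> x _; rewrite normrM ler_wpM2r.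
Qed.

Lemma convolDr K (M : R) a b t : measurable_fun setT K ->
  (forall x, `|K x| <= M) -> L1 a -> L1 b ->
  convol K (fun x => a x + b x) t = convol K a t + convol K b t.
Proof.
move=> mK KM ia ib; rewrite /convol.
under eq_Rintegral do rewrite mulrDr.
by rewrite RintegralD//; exact: (L1_convol_integrand t mK KM).
Qed.

Lemma convolZr K (M : R) c a t : measurable_fun setT K ->
  (forall x, `|K x| <= M) -> L1 a ->
  convol K (fun x => c * a x) t = c * convol K a t.
Proof.
move=> mK KM ia; rewrite /convol.
under eq_Rintegral do rewrite mulrCA.
by rewrite RintegralZl//; exact: (L1_convol_integrand t mK KM).
Qed.

Lemma is_ac_deriv_L1 T f g : is_ac_deriv T f g -> L1 (g \_ `[0, T]).
Proof. by move=> [ig _]; exact: L1_patch. Qed.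

Lemma is_ac_derivE T f g t : is_ac_deriv T f g -> 0 <= t <= T ->
  f t = f 0 + convol heav (g \_ `[0, T]) t.
Proof.
by move=> [_ fE] t0T; rewrite convol_heav_patch ?(andP t0T).2// fE.
Qed.

(** Both derivatives have the same primitive, so their difference vanishes almost everywhere. Hence
    the choice made by [ac_deriv] does not affect convolutions. *)
Lemma is_ac_deriv_convol T f g1 g2 K (M : R) t : 0 <= T ->
  is_ac_deriv T f g1 -> is_ac_deriv T f g2 ->
  measurable_fun setT K -> (forall x, `|K x| <= M) ->
  convol K (g1 \_ `[0, T]) t = convol K (g2 \_ `[0, T]) t.
Proof.
move=> T0 fg1 fg2 mK KM.
pose d x := (g1 \_ `[0, T]) x + (-1) * (g2 \_ `[0, T]) x.
have ig1 := is_ac_deriv_L1 fg1; have ig2 := is_ac_deriv_L1 fg2.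
have id : L1 d by apply: L1D => //; exact: L1Zl.
have dE K' M' s : measurable_fun setT K' -> (forall x, `|K' x| <= M') ->
    convol K' d s = convol K' (g1 \_ `[0, T]) s - convol K' (g2 \_ `[0, T]) s.
  move=> mK' KM'; rewrite (convolDr _ mK' KM')//; last exact: L1Zl.
  by rewrite (convolZr _ _ mK' KM')// mulN1r.
have d0 s : 0 <= s <= T -> convol heav d s = 0.
  move=> s0T; rewrite (dE _ 1); [|exact: measurable_heav|exact: heav_bounded].
  have := is_ac_derivE fg1 s0T; rewrite (is_ac_derivE fg2 s0T) => /addrI ->.
  by rewrite subrr.
have := @convol_primitive_eq0 _ K d t mK id.
rewrite (dE _ M)// => E; apply/eqP; rewrite -subr_eq0 E// => s.
(* The primitive of [d] vanishes for [s < 0] by causality, on [[0, T]] by [d0], and beyond [T] it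
   keeps its value at [T]. *)
case: (ltP s 0) => s0.
  apply: convol_lt0 => // [|y y0]; first exact: heav_lt0.
  by rewrite /d !patch_itv_lt0// mulr0 addr0.
case: (leP s T) => sT; first by rewrite d0 ?s0.
rewrite -(d0 T) ?T0 ?lexx//; apply: eq_Rintegral => x _.
case: (leP x T) => xT; first by rewrite !heav_ge0//; lra.
by rewrite /d !patchE !mem_setE !in_itv/= [x <= T]leNgt xT andbF !(mulr0, addr0).
Qed.

End Causal.

(** * Absolute continuity of J f and evaluation of D_phi *)

Section Main.
Context {R : realType}.
Notation mu := (@lebesgue_measure R).
Variables (T : R) (phi psi f g : R -> R).
Hypothesis T_gt0 : 0 < T.
Hypothesis psi_loc : loc_integrable_halfline psi.
Hypothesis fg : is_ac_deriv T f g.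

Let p := g \_ `[0, T].
Notation Phi := (phi \_ `[0, T]).
Notation Psi := (psi \_ `[0, T]).
Let q x := f 0 * Psi x + convol Psi p x.

Let ip : L1 p. Proof. exact: is_ac_deriv_L1 fg. Qed.
Let iPsi : L1 Psi. Proof. exact: L1_Psi. Qed.
Let p0 y : y < 0 -> p y = 0. Proof. exact: patch_itv_lt0. Qed.
Let Psi0 y : y < 0 -> Psi y = 0. Proof. exact: patch_itv_lt0. Qed.

Let iq : L1 q.
Proof. by apply: L1D; [exact: L1Zl|exact: L1_convol]. Qed.

Let q0 y : y < 0 -> q y = 0.
Proof. by move=> y0; rewrite /q Psi0// mulr0 add0r convol_lt0. Qed.

(** On [[0, T]], [f] is [F = f(0) H + H * p]; associativity then pulls [heav] out of the convolution
    with [Psi]. *)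
Lemma JopE r : 0 <= r <= T -> Jop psi f r = convol heav q r.
Proof.
move=> /andP[r0 rT].
pose F x := f 0 * heav x + convol heav p x.
have mheav := @measurable_heav R.
have hb := @heav_bounded R.
have mF : measurable_fun setT F.
  apply: measurable_funD; first exact: measurable_funM.
  by apply: measurable_convol => //; exact: L1_measurable.
have -> : Jop psi f r = convol Psi F r.
  rewrite convol_itv//; last first.
    by move=> y y0; rewrite /F heav_lt0// mulr0 add0r convol_lt0//; exact: heav_lt0.
  apply: eq_Rintegral => y; rewrite inE/= in_itv/= => /andP[y0 yr].
  rewrite patch_itv_id; last by lra.
  congr (_ * _); rewrite /F heav_ge0// mulr1 (is_ac_derivE fg)// y0/=.
  exact: le_trans yr rT.
(* The bounded factor [F] moves to the kernel position, as [convolA] and linearity require. *)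
rewrite convolC//; last exact: L1_measurable.
have [M HM] := convol_bounded mheav hb ip.
have mHp : measurable_fun setT (convol heav p).
  by apply: measurable_convol => //; exact: L1_measurable.
have -> : convol F Psi r = f 0 * convol heav Psi r + convol (convol heav p) Psi r.
  rewrite /F; move: (convol heav p) HM mHp => C HM mHp; rewrite /convol.
  under eq_Rintegral do rewrite mulrDl -mulrA.
  rewrite RintegralD//; last 2 first.
  - exact: L1Zl (L1_convol_integrand r mheav hb iPsi).
  - exact: (L1_convol_integrand r mHp HM iPsi).
  rewrite RintegralZl//; exact: (L1_convol_integrand r mheav hb iPsi).
rewrite -(convolA _ mheav hb)//.
have -> : convol p Psi = convol Psi p.
  by apply/funext => x; apply: convolC; exact: L1_measurable.
rewrite /q (convolDr _ mheav hb)//; last 2 first.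
- exact: L1Zl.
- exact: L1_convol.
by rewrite (convolZr _ _ mheav hb).
Qed.

Lemma Jop_cvg0 : Jop psi f r @[r --> 0^'+] --> 0.
Proof.
have iq0T : mu.-integrable `[0, T] (EFin \o q) by exact: integrableS iq.
have := parameterized_integral_cvg_left T_gt0 iq0T.
move=> /cvg_at_right_filter; apply: cvg_trans; apply: near_eq_cvg; near=> r.
rewrite JopE ?convol_heav_itv//.
apply/andP; split; first by apply: ltW; near: r; exact: nbhs_right_gt.
by apply: ltW; near: r; exact: nbhs_right_lt.
Unshelve. all: by end_near. Qed.

Let w x := (phi 0)^-1 * p x + q x.

Lemma is_ac_deriv_Jtilde : is_ac_deriv T (Jtilde phi psi f) w.
Proof.
have iw : L1 w by apply: L1D => //; exact: L1Zl.
split; first exact: integrableS iw.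
move=> t t0T; have hb := @heav_bounded R; have mh := @measurable_heav R.
rewrite -convol_heav_itv; last first.
  by move=> y y0; rewrite /w p0// q0// mulr0 addr0.
rewrite /w (convolDr _ mh hb)//; last exact: L1Zl.
rewrite (convolZr _ _ mh hb)//.
rewrite /Jtilde (JopE t0T) (is_ac_derivE fg t0T).
(* At 0 the operator integrates over a single point, so it contributes nothing to the initial
   value. *)
rewrite /Jop set_itv1 Rintegral_set1; ring.
Qed.

Hypothesis phi_cont : {within `[0, T], continuous phi}.
Hypothesis volterraE : forall t, 0 <= t <= T ->
  convol Phi Psi t = 1 - phi t / phi 0.

Lemma Dop_Jtilde t : 0 < t <= T ->
  Dop T phi (Jtilde phi psi f) t = f t - phi t / phi 0 * f 0.
Proof.
move=> /andP[t0 tT].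
have [M PhiM] := Phi_bounded T_gt0 phi_cont.
have iPhi := L1_Phi phi_cont; have mPhi := L1_measurable iPhi.
have t0T : 0 <= t <= T by rewrite ltW.
have iw : L1 w by apply: L1D => //; exact: L1Zl.
(* [Dop] uses a chosen derivative; since [w] is one, the choice is a genuine derivative and can be
   exchanged for [w] against the bounded kernel [Phi]. *)
have Gderiv : is_ac_deriv T (Jtilde phi psi f) (ac_deriv T (Jtilde phi psi f)).
  apply: (@xgetPex _ _ (is_ac_deriv T (Jtilde phi psi f))).
  by exists w; exact: is_ac_deriv_Jtilde.
rewrite /Dop -(convol_patch _ _ tT).
rewrite (is_ac_deriv_convol _ _ Gderiv is_ac_deriv_Jtilde mPhi PhiM) ?ltW//.
have -> : convol Phi (w \_ `[0, T]) t = convol Phi w t.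
  rewrite !convol_itv; try exact: patch_itv_lt0; last first.
    by move=> y y0; rewrite /w p0// q0// mulr0 addr0.
  apply: eq_Rintegral => y; rewrite inE/= in_itv/= => /andP[y0 yt].
  by rewrite (@patch_itv_id _ _ w) ?y0 ?(le_trans yt).
rewrite /w (convolDr _ mPhi PhiM)//; last exact: L1Zl.
rewrite (convolZr _ _ mPhi PhiM)//.
rewrite /q (convolDr _ mPhi PhiM)//; last 2 first.
- exact: L1Zl.
- exact: L1_convol.
rewrite (convolZr _ _ mPhi PhiM)// volterraE// (convolA _ mPhi PhiM)//.
(* The Volterra identity is known on [[0, T]], which suffices: [p] vanishes for [x < 0], and all
   three kernels vanish at [t - x] for [x > t]. *)
have -> : convol (convol Phi Psi) p t =
    convol heav p t - (phi 0)^-1 * convol Phi p t.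
  have iPhip := L1_convol_integrand t mPhi PhiM ip.
  have C0 y : y < 0 -> convol Phi Psi y = 0.
    by move=> y0; rewrite convol_lt0//; exact: patch_itv_lt0.
  move: (convol Phi Psi) C0 volterraE => C C0 CE.
  rewrite /convol -RintegralZl// -RintegralB//; last 2 first.
  - exact: (L1_convol_integrand t (@measurable_heav R) (@heav_bounded R) ip).
  - exact: L1Zl iPhip.
  apply: eq_Rintegral => x _; case: (ltP x 0) => x0; first by rewrite p0// !mulr0 subr0.
  case: (leP x t) => xt; last first.
    by rewrite C0 ?heav_lt0 ?patch_itv_lt0 ?(mul0r, mulr0, subr0)//; lra.
  rewrite CE ?heav_ge0 ?patch_itv_id; [ring|lra|lra|lra].
by rewrite (is_ac_derivE fg t0T) -/p; ring.
Qed.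

End Main.

Theorem theorem3p2 (R : realType) (T : R) (phi psi : R -> R)
  (T_gt0 : 0 < T)
  (phi_cont : {within `[0, T], continuous phi})
  (phi_diff : forall t : R, 0 < t < T -> derivable phi t 1)
  (dphi_int : exists2 delta : R, 0 < delta < T &
     (@lebesgue_measure R).-integrable `]0, delta[ (EFin \o derive1 phi))
  (phi0_neq0 : phi 0 != 0)
  (psi_loc : loc_integrable_halfline psi)
  (psi_laplace : \forall s \near +oo,
     has_laplace psi s /\
     laplace psi s = 1 / (s * laplace (zero_ext T phi) s) - 1 / phi 0)
  (f : R -> R) (f_AC : abs_cont T f) :
  [/\ abs_cont T (Jtilde phi psi f),
      cvg (Jop psi f r @[r --> 0^'+]) &
      forall t : R, 0 < t <= T ->
        Dop T phi (Jtilde phi psi f) t =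
          f t - phi t / phi 0 * f 0
              - phi t * lim (Jop psi f r @[r --> 0^'+])].
Proof.
have [g fg] := f_AC.
have J0 := Jop_cvg0 T_gt0 psi_loc fg.
split.
- by eexists; exact: is_ac_deriv_Jtilde T_gt0 psi_loc fg.
- by apply/cvg_ex; exists 0.
- move=> t t0T.
  (* [Jop_cvg0] evaluates the limit as 0. *)
  rewrite (cvg_lim _ J0)//= mulr0 subr0.
  apply: (Dop_Jtilde T_gt0 psi_loc fg phi_cont _ t0T) => s s0T.
  exact: volterra.
Qed.
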